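(* Let $G,H,F$ be graphs and let $\odot$ be an adjacency product. If there exists a b-homomorphism from $H$ to $F$, then there exists a b-homomorphism from $G\odot H$ to $G\odot F$, and there exists a b-homomorphism from $H\odot G$ to $F\odot G$.
   Context: Graphs are finite, simple and nonempty. A homomorphism from $G$ to $H$ is a function $f:V(G)\to V(H)$ with $f(u)f(v)\in E(H)$ for every $uv\in E(G)$. A b-homomorphism from $G$ to $H$ is a homomorphism $f$ such that for every $u\in V(H)$ there exists $u'\in f^{-1}(u)$ with $f(N_G(u'))=N_H(u)$ (so $f$ is surjective). An adjacency product $\odot$ assigns to graphs $G,H$ the simple graph $G\odot H$ on $V(G)\times V(H)$ in which $\alpha=(u_a,v_a)$ and $\beta=(u_b,v_b)$ are adjacent iff a condition $P_\odot(G,H,\alpha,\beta)$ holds, where $P_\odot$ is a fixed formula (the same for all $G,H$) built by conjunctions and disjunctions (no negations) from a subset of the four basic formulas $u_a=u_b$, $v_a=v_b$, $u_au_b\in E(G)$, $v_av_b\in E(H)$; since the product is a simple graph, $P_\odot(G,H,\alpha,\alpha)$ never holds. *)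

(* Defs.v *)
From mathcomp Require Import all_boot.

Set Implicit Arguments.
Unset Strict Implicit.
Unset Printing Implicit Defensive.

Record sgraph := SGraph {
  vertex :> finType;
  adj : rel vertex;
  adj_sym : symmetric adj;
  adj_irrefl : irreflexive adj;
  vertex_gt0 : 0 < #|vertex| }.

Definition neighbours (G : sgraph) (u : G) : {set G} := [set v | adj u v].

Definition homomorphism (G H : sgraph) (f : G -> H) : Prop :=
  forall u v : G, adj u v -> adj (f u) (f v).

Definition b_homomorphism (G H : sgraph) (f : G -> H) : Prop :=
  homomorphism f /\
  forall u : H, exists2 u' : G,
    f u' = u & f @: neighbours u' = neighbours u.

(* Negation-free formulas over the four atoms u_a = u_b, v_a = v_b,
   u_a u_b \in E(G), v_a v_b \in E(H).  There are no constants: each formula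
   uses at least one atom. *)
Inductive pformula :=
  | EqL
  | EqR
  | AdjL
  | AdjR
  | And of pformula & pformula
  | Or of pformula & pformula.

Fixpoint holds (G H : sgraph) (P : pformula) (a b : G * H) : bool :=
  match P with
  | EqL => a.1 == b.1
  | EqR => a.2 == b.2
  | AdjL => adj a.1 b.1
  | AdjR => adj a.2 b.2
  | And P1 P2 => holds P1 a b && holds P2 a b
  | Or P1 P2 => holds P1 a b || holds P2 a b
  end.

(* One formula serves all pairs of graphs; [loopless] is what makes every
   product a simple graph. *)
Record adjacency_product := AdjacencyProduct {
  condition : pformula;
  loopless : forall (G H : sgraph) (a : G * H), ~~ holds condition a a }.

Section Product.
Variables (P : adjacency_product) (G H : sgraph).

Definition product_adj : rel (G * H)%type := @holds G H (condition P).

Lemma product_adj_sym : symmetric product_adj.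
Proof.
move=> a b; rewrite /product_adj.
by elim: (condition P) => [||||p IHp q IHq|p IHp q IHq] /=;
  rewrite ?IHp ?IHq // ?[_ == _]eq_sym // adj_sym.
Qed.

Lemma product_adj_irrefl : irreflexive product_adj.
Proof. by move=> a; apply/negbTE/loopless. Qed.

Lemma product_vertex_gt0 : 0 < #|{: G * H}|.
Proof. by rewrite card_prod muln_gt0 !vertex_gt0. Qed.

Definition product : sgraph :=
  SGraph product_adj_sym product_adj_irrefl product_vertex_gt0.

End Product.

(* Main.v *)
Require Import Defs.
From mathcomp Require Import all_boot.

(** The product of two b-homomorphisms [f1] and [f2], acting coordinatewise, is
    a b-homomorphism between the adjacency products; both claims are the case
    in which one of the factors is the identity.

    The condition of the product is monotone in its four atoms, as it has no
    negation ([holds_mono]).  Homomorphisms preserve equality and adjacency in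
    each coordinate, hence they preserve the condition.  For the other half,
    a vertex [u] has a preimage [u'] relative to which every vertex [v] lifts
    to a [v'] standing to [u'] in at least the relations, among equality and
    adjacency, in which [v] stands to [u] ([b_homomorphism_lift]).  Lifting the
    two coordinates of a neighbour separately therefore makes every atom that
    was true downstairs true upstairs, and by monotonicity the lifted pair is a
    neighbour in the product. *)

Lemma holds_mono (G H G' H' : sgraph) (P : pformula)
    (a b : G * H) (a' b' : G' * H') :
  (a.1 = b.1 -> a'.1 = b'.1) -> (a.2 = b.2 -> a'.2 = b'.2) ->
  (adj a.1 b.1 -> adj a'.1 b'.1) -> (adj a.2 b.2 -> adj a'.2 b'.2) ->
  holds P a b -> holds P a' b'.
Proof.
move=> eqL eqR adjL adjR.
elim: P => [||||p IHp q IHq|p IHp q IHq] //=.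
- by move/eqP/eqL/eqP.
- by move/eqP/eqR/eqP.
- by case/andP=> /IHp-> /IHq.
- by case/orP=> [/IHp->|/IHq->] //; rewrite orbT.
Qed.

(** The vertices [v] fall into three disjoint classes: [u] itself lifts to
    [u'], where irreflexivity leaves no adjacency to lift; a neighbour of [u]
    lifts to a neighbour of [u'] by the choice of [u']; and for any other [v]
    nothing is required beyond the surjectivity of [f]. *)
Lemma b_homomorphism_lift (H F : sgraph) (f : H -> F) (u : F) :
  b_homomorphism f ->
  exists2 u' : H, f u' = u &
    forall v : F, exists2 v' : H, f v' = v &
      (u = v -> u' = v') /\ (adj u v -> adj u' v').
Proof.
case=> _ f_b; have [u' fu' fN] := f_b u; exists u' => // v.
have [<-|neq_uv] := eqVneq u v.
  by exists u' => //; rewrite adj_irrefl.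
have [uv|_] := boolP (adj u v).
  have: v \in f @: neighbours u' by rewrite fN inE.
  case/imsetP=> v'; rewrite inE => u'v' def_v.
  by exists v' => //; split=> // /eqP; rewrite (negPf neq_uv).
have [v' fv' _] := f_b v.
by exists v' => //; split=> // /eqP; rewrite (negPf neq_uv).
Qed.

Lemma b_homomorphism_id (G : sgraph) : b_homomorphism (fun x : G => x).
Proof. by split=> // u; exists u; rewrite ?imset_id. Qed.

Lemma b_homomorphism_product (P : adjacency_product) (G H G' H' : sgraph)
    (f1 : G -> G') (f2 : H -> H') :
  b_homomorphism f1 -> b_homomorphism f2 ->
  @b_homomorphism (product P G H) (product P G' H') (fun a => (f1 a.1, f2 a.2)).
Proof.
move=> f1_b f2_b; set g : product P G H -> product P G' H' := (X in b_homomorphism X).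
have g_hom : homomorphism g.
  move=> a b; apply: holds_mono => /=; try by move->.
    exact: f1_b.1.
  exact: f2_b.1.
split=> // -[u w].
have [u' fu' lift1] := b_homomorphism_lift _ _ f1 u f1_b.
have [w' fw' lift2] := b_homomorphism_lift _ _ f2 w f2_b.
have gu : g (u', w') = (u, w) by rewrite /g /= fu' fw'.
exists (u', w') => //; apply/setP=> -[v x]; apply/imsetP/idP.
  by case=> b; rewrite !inE => /g_hom adj_gb ->; rewrite -gu.
rewrite inE => uw_vx.
have [v' fv' [eq1 adj1]] := lift1 v.
have [x' fx' [eq2 adj2]] := lift2 x.
exists (v', x'); last by rewrite /g /= fv' fx'.
by rewrite inE; apply: holds_mono uw_vx.
Qed.

Theorem lemma2 (G H F : sgraph) (P : adjacency_product) :
  (exists f : H -> F, b_homomorphism f) ->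
  (exists g : product P G H -> product P G F, b_homomorphism g) /\
  (exists g : product P H G -> product P F G, b_homomorphism g).
Proof.
case=> f f_b; split; eexists.
  exact: b_homomorphism_product (b_homomorphism_id G) f_b.
exact: b_homomorphism_product f_b (b_homomorphism_id G).
Qed.
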